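(* For every Veltman frame $F=\langle W,R,\{S_x\}_{x\in W}\rangle$ and each natural number $n\geq 0$, we have $F\models\mathcal F^n$ if and only if $F\models\mathsf R^n$.
   Context: Modal language: propositional logic with a unary operator $\Box$ (with $\Diamond=\neg\Box\neg$) and a binary operator $\rhd$. Binding conventions: $\neg,\Box,\Diamond$ bind strongest, then $\wedge,\vee$, then $\rhd$, then $\to$ (weakest). A Veltman frame is a triple $\langle W,R,\{S_x\}_{x\in W}\rangle$ with $W\neq\emptyset$; $R$ a transitive binary relation on $W$ with no infinite ascending chain $x_0Rx_1Rx_2\cdots$; and, for each $x$, $S_x$ a reflexive and transitive binary relation on $x{\uparrow}:=\{y\mid xRy\}$ containing the restriction of $R$ to $x{\uparrow}$. A forcing relation $\Vdash$ on the frame is induced by a valuation of propositional variables, commutes with the Boolean connectives, and satisfies: $x\Vdash\Box A$ iff $\forall y\,(xRy\to y\Vdash A)$; $x\Vdash A\rhd B$ iff $\forall y\,\big(xRy\wedge y\Vdash A\to\exists z\,(yS_xz\wedge z\Vdash B)\big)$. For a modal scheme $\mathsf P$, $F\models\mathsf P$ means that under every valuation on $F$, every instance of $\mathsf P$ is forced at every world; for a first-order sentence in the language $\{R,\{S_x\}_{x\in W}\}$, $F\models$ means truth in $F$ as a relational structure. Schemes ($A,B,C,D_i$ are placeholders for arbitrary modal formulas): $\mathsf U_1:=\Diamond\neg(D_1\rhd\neg C)$; $\mathsf U_{n+2}:=\Diamond\big((D_{n+1}\rhd D_{n+2})\wedge\mathsf U_{n+1}\big)$ for $n\ge 0$; $\mathsf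 R^0:=A\rhd B\to\neg(A\rhd\neg C)\rhd B\wedge\Box C$; $\mathsf R^{n+1}:=A\rhd B\to\mathsf U_{n+1}\wedge(D_{n+1}\rhd A)\rhd B\wedge\Box C$. Frame conditions: $\mathcal B_0(x_1,x_0,y_0,y_1):=x_1Rx_0\wedge x_0Ry_0\wedge y_0S_{x_1}y_1$; $\mathcal B_{n+1}(x_{n+2},x_0,y_0,y_{n+2}):=\exists x_{n+1},y_{n+1}\,\big(x_{n+2}Rx_{n+1}\wedge\mathcal B_n(x_{n+1},x_0,y_0,y_{n+1})\wedge y_{n+1}S_{x_{n+2}}y_{n+2}\big)$; $\mathcal F^n:=\forall x_{n+1},x_0,y_0,y_{n+1}\,\big(\mathcal B_n(x_{n+1},x_0,y_0,y_{n+1})\Rightarrow\forall u\,(y_{n+1}Ru\Rightarrow y_0S_{x_0}u)\big)$. *)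

(* Defs.v *)
From Stdlib Require Import Relation_Definitions.

Record VeltmanFrame : Type := {
  World :> Type;
  Rrel : relation World;
  Srel : World -> relation World;
  World_inhabited : inhabited World;
  R_trans : transitive World Rrel;
  R_no_chain : ~ exists f : nat -> World, forall i, Rrel (f i) (f (S i));
  S_dom : forall x y z, Srel x y z -> Rrel x y /\ Rrel x z;
  S_refl : forall x y, Rrel x y -> Srel x y y;
  S_trans : forall x, transitive World (Srel x);
  S_incl_R : forall x y z, Rrel x y -> Rrel x z -> Rrel y z -> Srel x y z
}.

Arguments Rrel {_} _ _.
Arguments Srel {_} _ _ _.

Inductive form : Type :=
| Var : nat -> form
| Bot : form
| Neg : form -> form
| And : form -> form -> form
| Or : form -> form -> form
| Imp : form -> form -> form
| Box : form -> form
| Rhd : form -> form -> form.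

Definition Dia (A : form) : form := Neg (Box (Neg A)).

Declare Scope modal_scope.
Delimit Scope modal_scope with modal.
Bind Scope modal_scope with form.

Notation "¬ A" := (Neg A) (at level 35, right associativity) : modal_scope.
Notation "□ A" := (Box A) (at level 35, right associativity) : modal_scope.
Notation "◇ A" := (Dia A) (at level 35, right associativity) : modal_scope.
Notation "A ∧ B" := (And A B) (at level 40, left associativity) : modal_scope.
Notation "A ▷ B" := (Rhd A B) (at level 60, no associativity) : modal_scope.
Notation "A → B" := (Imp A B) (at level 65, right associativity) : modal_scope.

Fixpoint forces {F : VeltmanFrame} (V : nat -> F -> Prop) (x : F) (A : form)
  {struct A} : Prop :=
  match A with
  | Var p => V p x
  | Bot => False
  | Neg B => ~ forces V x B
  | And B C => forces V x B /\ forces V x C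
  | Or B C => forces V x B \/ forces V x C
  | Imp B C => forces V x B -> forces V x C
  | Box B => forall y, Rrel x y -> forces V y B
  | Rhd B C => forall y, Rrel x y /\ forces V y B ->
                 exists z, Srel x y z /\ forces V z C
  end.

(* A scheme is identified with the set of its instances. *)
Definition scheme : Type := form -> Prop.

Definition validates (F : VeltmanFrame) (P : scheme) : Prop :=
  forall (V : nat -> F -> Prop) (A : form), P A -> forall x : F, forces V x A.

(* [U n C D] is $\mathsf U_{n+1}$; [D i] stands for $D_i$, so [D 0] is unused. *)
Fixpoint U (n : nat) (C : form) (D : nat -> form) : form :=
  match n with
  | 0 => ◇ ¬ (D 1 ▷ ¬ C)
  | S m => ◇ ((D (m + 1) ▷ D (m + 2)) ∧ U m C D)
  end%modal.

Definition R_instance (n : nat) (A B C : form) (D : nat -> form) : form :=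
  match n with
  | 0 => A ▷ B → ¬ (A ▷ ¬ C) ▷ B ∧ □ C
  | S m => A ▷ B → U m C D ∧ (D (m + 1) ▷ A) ▷ B ∧ □ C
  end%modal.

Definition R_scheme (n : nat) : scheme :=
  fun E => exists (A B C : form) (D : nat -> form), E = R_instance n A B C D.

(* [B_cond n x x0 y0 y] is $\mathcal B_n(x_{n+1}, x_0, y_0, y_{n+1})$. *)
Fixpoint B_cond {F : VeltmanFrame} (n : nat) (x x0 y0 y : F) : Prop :=
  match n with
  | 0 => Rrel x x0 /\ Rrel x0 y0 /\ Srel x y0 y
  | S m =>
      exists x' y' : F, Rrel x x' /\ B_cond m x' x0 y0 y' /\ Srel x y' y
  end.

Definition F_cond (F : VeltmanFrame) (n : nat) : Prop :=
  forall x x0 y0 y : F, B_cond n x x0 y0 y -> forall u : F, Rrel y u -> Srel x0 y0 u.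

(* Main.v *)
Require Import Defs.
From Stdlib Require Import Arith Lia Classical.

(** Why the correspondence holds.

    Write the instance of [R^n] as [A ▷ B → E_n ▷ B ∧ □ C], where [E_n] is
    [antecedent n A C D] below.  The formulas [E_n] obey a single recursion:
    [U_{n+1}] says that some successor forces [E_n] with [A := D_{n+1}], and
    [E_{n+1}] is [U_{n+1} ∧ (D_{n+1} ▷ A)].  This is the same recursion as that
    of the frame condition: a world seeing [E_n] and forcing [A ▷ B] is the top
    [x_{n+1}] of a configuration [B_n(x_{n+1}, x_0, y_0, y_{n+1})].

    From the frame condition to the scheme, [antecedent_B_cond] extracts from
    [E_n] and [A ▷ B] such a configuration in which [y_{n+1}] forces [B] and all
    [S_{x_0}]-successors of [y_0] force [C].  The frame condition puts every
    [R]-successor of [y_{n+1}] among the latter, so [y_{n+1}] forces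
    [B ∧ □ C].

    Conversely, [B_cond_chain] unfolds a configuration into chains
    [x_0, ..., x_{n+1}] and [y_0, ..., y_{n+1}].  Interpret [D_{i+1}] as
    [{y_i}], continue with [A] as [{y_n}] and [B] as [{y_{n+1}}], and let [C]
    hold exactly at the [S_{x_0}]-successors of [y_0].  Then [x_n] forces [E_n]
    ([chain_antecedent]) and [x_{n+1}] forces [A ▷ B], so the scheme yields a
    world forcing [B ∧ □ C].  That world can only be [y_{n+1}], and [□ C] at
    [y_{n+1}] is the frame condition. *)

Definition antecedent (n : nat) (A C : form) (D : nat -> form) : form :=
  match n with
  | 0 => ¬ (A ▷ ¬ C)
  | S m => U m C D ∧ (D (m + 1) ▷ A)
  end%modal.

Lemma R_instance_antecedent n A B C D :
  R_instance n A B C D = (A ▷ B → antecedent n A C D ▷ B ∧ □ C)%modal.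
Proof. destruct n; reflexivity. Qed.

Section Forcing.

Context {F : VeltmanFrame} (V : nat -> F -> Prop).

Lemma forces_Dia x A :
  forces V x (Dia A) <-> exists y, Rrel x y /\ forces V y A.
Proof.
  cbn; split.
  - intros H; apply NNPP; intros Hno; apply H; intros y Hxy HA.
    apply Hno; eauto.
  - intros (y & Hxy & HA) H; exact (H y Hxy HA).
Qed.

Lemma forces_not_Rhd_not x A C :
  forces V x (Neg (Rhd A (Neg C))) <->
  exists y, Rrel x y /\ forces V y A /\
            forall z, Srel x y z -> forces V z C.
Proof.
  cbn; split.
  - intros H; apply NNPP; intros Hno; apply H; intros y [Hxy HA].
    apply NNPP; intros Hz; apply Hno; exists y; repeat split; trivial.
    intros z Hyz; apply NNPP; intros HC; apply Hz; eauto.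
  - intros (y & Hxy & HA & HC) H.
    destruct (H y (conj Hxy HA)) as (z & Hyz & HnC); auto.
Qed.

(** Makes the recursion of the schemes uniform: the base case and the step of
    [U] become one clause, matching the step of [B_cond]. *)
Lemma forces_U n x C D :
  forces V x (U n C D) <->
  exists y, Rrel x y /\ forces V y (antecedent n (D (n + 1)) C D).
Proof.
  destruct n as [|m]; unfold U; fold U; rewrite forces_Dia.
  - reflexivity.
  - replace (S m + 1) with (m + 2) by lia.
    cbn [antecedent forces]; firstorder.
Qed.

Lemma B_cond_Rrel n (x x0 y0 y : F) : B_cond n x x0 y0 y -> Rrel x y.
Proof.
  destruct n; cbn; intros H.
  - apply (S_dom F x y0 y), H.
  - destruct H as (x' & y' & _ & _ & H); apply (S_dom F x y' y), H.
Qed.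

(** The [D_i] are handed upwards along the nested diamonds: the world [y_0]
    forcing [D_1] is moved by each [D_i ▷ D_{i+1}] in turn, and finally by
    [A ▷ B].  The world [x'] sees the last but one of the resulting worlds,
    which gives [Srel x x' y]. *)
Lemma antecedent_B_cond n : forall x x' A B C D,
  Rrel x x' -> forces V x' (antecedent n A C D) -> forces V x (Rhd A B) ->
  exists x0 y0 y,
    B_cond n x x0 y0 y /\ Srel x x' y /\ forces V y B /\
    forall z, Srel x0 y0 z -> forces V z C.
Proof.
  induction n as [|n IH]; intros x x' A B C D Hxx' Hante HAB.
  - apply forces_not_Rhd_not in Hante; destruct Hante as (y0 & Hx'y0 & HA & HC).
    assert (Hxy0 : Rrel x y0) by (eapply R_trans; eauto).
    destruct (HAB y0 (conj Hxy0 HA)) as (y & Hy0y & HB).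
    exists x', y0, y; repeat split; trivial.
    apply S_trans with y0; trivial; apply S_incl_R; trivial.
  - destruct Hante as [HU HDA].
    apply forces_U in HU; destruct HU as (x'' & Hx'x'' & Hante).
    destruct (IH x' x'' _ _ _ _ Hx'x'' Hante HDA)
      as (x0 & y0 & y' & HBn & _ & HA & HC).
    assert (Hx'y' : Rrel x' y') by exact (B_cond_Rrel _ _ _ _ _ HBn).
    assert (Hxy' : Rrel x y') by (eapply R_trans; eauto).
    destruct (HAB y' (conj Hxy' HA)) as (y & Hy'y & HB).
    exists x0, y0, y; repeat split; trivial.
    + exists x', y'; auto.
    + apply S_trans with y'; trivial; apply S_incl_R; trivial.
Qed.

End Forcing.

Definition chain {F : VeltmanFrame} (n : nat) (X Y : nat -> F) : Prop :=
  Rrel (X 0) (Y 0) /\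
  forall i, i <= n -> Rrel (X (S i)) (X i) /\ Srel (X (S i)) (Y i) (Y (S i)).

(** Having the whole chain at once lets a single valuation be fixed before the
    induction that evaluates the nested diamonds. *)
Lemma B_cond_chain {F : VeltmanFrame} n : forall x x0 y0 y : F,
  B_cond n x x0 y0 y ->
  exists X Y : nat -> F,
    chain n X Y /\ X 0 = x0 /\ Y 0 = y0 /\ X (S n) = x /\ Y (S n) = y.
Proof.
  induction n as [|n IH]; intros x x0 y0 y.
  - intros (Hxx0 & Hx0y0 & Hy0y).
    exists (fun i => match i with 0 => x0 | _ => x end),
           (fun i => match i with 0 => y0 | _ => y end).
    repeat split; trivial; replace i with 0 by lia; trivial.
  - intros (x' & y' & Hxx' & HB & Hy'y).
    destruct (IH _ _ _ _ HB) as (X & Y & [H0 Hstep] & <- & <- & <- & <-).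
    exists (fun i => if i <=? S n then X i else x),
           (fun i => if i <=? S n then Y i else y).
    assert (Hlast : (S (S n) <=? S n) = false) by (apply Nat.leb_gt; lia).
    rewrite Hlast; split; [|auto].
    split; [exact H0|].
    intros i Hi; rewrite (leb_correct i (S n)) by lia.
    destruct (Nat.eq_dec i (S n)) as [->|Hne].
    + rewrite Hlast; auto.
    + rewrite (leb_correct (S i) (S n)) by lia; apply Hstep; lia.
Qed.

(** Variable [0] stands for [C], and variable [i + 1] names the world [y_i]. *)
Definition chain_val {F : VeltmanFrame} (X Y : nat -> F) (p : nat) (z : F) :
    Prop :=
  match p with
  | 0 => Srel (X 0) (Y 0) z
  | S i => z = Y i
  end.

Lemma chain_Rhd {F : VeltmanFrame} n (X Y : nat -> F) i :
  chain n X Y -> i <= n ->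
  forces (chain_val X Y) (X (S i)) (Rhd (Var (S i)) (Var (S (S i)))).
Proof.
  intros [_ Hstep] Hi y [_ Hy]; cbn in Hy; subst y.
  exists (Y (S i)); split; [apply Hstep, Hi | reflexivity].
Qed.

Lemma chain_antecedent {F : VeltmanFrame} n (X Y : nat -> F) i :
  chain n X Y -> i <= n ->
  forces (chain_val X Y) (X i) (antecedent i (Var (S i)) (Var 0) Var).
Proof.
  intros Hch; induction i as [|i IH]; intros Hi.
  - apply forces_not_Rhd_not; exists (Y 0); repeat split.
    + apply Hch.
    + intros z Hz; exact Hz.
  - split; [apply forces_U; exists (X i)|]; rewrite Nat.add_1_r.
    + split; [apply Hch; lia | apply IH; lia].
    + apply chain_Rhd with n; [exact Hch | lia].
Qed.

Theorem theorem4p5 (F : VeltmanFrame) (n : nat) :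
  F_cond F n <-> validates F (R_scheme n).
Proof.
  split.
  - intros HF V E (A & B & C & D & ->) x.
    rewrite R_instance_antecedent; intros HAB x' [Hxx' Hante].
    destruct (antecedent_B_cond V n x x' A B C D Hxx' Hante HAB)
      as (x0 & y0 & y & HBn & Hx'y & HB & HC).
    exists y; repeat split; trivial.
    intros u Hyu; apply HC; exact (HF _ _ _ _ HBn u Hyu).
  - intros Hval x x0 y0 y HBn u Hyu.
    destruct (B_cond_chain n x x0 y0 y HBn)
      as (X & Y & Hch & <- & <- & <- & <-).
    assert (HR : forces (chain_val X Y) (X (S n))
                   (R_instance n (Var (S n)) (Var (S (S n))) (Var 0) Var)).
    { apply Hval; repeat eexists. }
    rewrite R_instance_antecedent in HR.
    destruct (HR (chain_Rhd n X Y n Hch (le_n n)) (X n))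
      as (z & _ & Hz & HboxC).
    + split; [apply Hch, le_n | apply chain_antecedent with n; auto].
    + cbn in Hz; subst z; exact (HboxC u Hyu).
Qed.
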